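(* For each $\theta \ge 1$, consider the scalar decomposed-dynamics problem with $a = 1$, i.e. dynamics $\dot x = x + b u$, where the task parameter $b$ ranges over $\mathbf{B}_\theta = [\frac{1}{\theta}, 1]$. If $\alpha \geq \frac{3}{2}$, then the $\alpha$-suboptimal covering number satisfies $N_\alpha(\mathbf{B}_\theta) = \Omega(\log \theta)$ as $\theta \to \infty$, with $\alpha$ fixed.
   Context: Scalar problem: the state space is $\mathbb{R}$ and the action space is $\mathbb{R}$. For a task $b$ and a policy $\pi : \mathbb{R} \to \mathbb{R}$, the cost is $$J_b(\pi) = \mathbb{E}_{x(0) \sim \mathcal{N}(0,1)} \int_0^\infty \big(x(t)^2 + u(t)^2\big)\,dt,$$ where $\dot x = a x + b u$ (with $a = 1$ here) and $u = \pi(x)$. The cost may equal $+\infty$, and we set $J_b(\pi) = +\infty$ whenever the closed-loop system does not define a global trajectory. Reference policies are the linear ones, $\pi(x) = kx$ with $k \in \mathbb{R}$, and $J^\star_b = \min_{k \in \mathbb{R}} J_b(k)$, where $J_b(k)$ denotes the cost of $u = kx$. For $\alpha > 1$, the $\alpha$-suboptimal neighborhood of a policy $\pi$ is $\mathscr{N}_\alpha(\pi) = \{ b \in \mathbf{B}_\theta : J_b(\pi)/J^\star_b \leq \alpha\}$. A set $\mathcal{C}$ of policies $\mathbb{R} \to \mathbb{R}$ is an $\alpha$-suboptimal cover of $\mathbf{B}_\theta$ if $\bigcup_{\pi \in \mathcal{C}} \mathscr{N}_\alpha(\pi) = \mathbf{B}_\theta$. The covering number $N_\alpha(\mathbf{B}_\theta)$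 is the size of the smallest finite $\alpha$-suboptimal cover if one exists, and $\infty$ otherwise. *)

(* Defs.v *)
From HB Require Import structures.
From mathcomp Require Import all_boot all_order all_algebra.
From mathcomp Require Import all_classical all_reals all_analysis.

Set Implicit Arguments.
Unset Strict Implicit.
Unset Printing Implicit Defensive.

Import Order.TTheory GRing.Theory Num.Theory.
Import numFieldNormedType.Exports.

Local Open Scope classical_set_scope.
Local Open Scope ring_scope.

(* Policies are arbitrary functions, so the closed-loop vector field may be
   discontinuous and solutions are taken in the sense of Caratheodory, i.e. as
   solutions of the integral equation. Only the values of x at nonnegative
   times matter. *)
Definition is_trajectory (R : realType) (a b : R) (policy : R -> R) (x0 : R)
    (x : R -> R) : Prop :=
  forall T : R, 0 <= T ->
    (@lebesgue_measure R).-integrable `[0, T]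
      (fun t => (a * x t + b * policy (x t))%:E) /\
    x T = x0 + \int[@lebesgue_measure R]_(t in `[0, T])
                 (a * x t + b * policy (x t)).

Definition defines_trajectory (R : realType) (a b : R) (policy : R -> R)
    (x0 : R) : Prop :=
  exists2 x : R -> R, is_trajectory a b policy x0 x &
    forall y : R -> R, is_trajectory a b policy x0 y ->
      forall t : R, 0 <= t -> y t = x t.

(* Meaningful only under [defines_trajectory a b policy x0]; the constant
   function is a junk value. *)
Definition trajectory (R : realType) (a b : R) (policy : R -> R) (x0 : R) :
    R -> R :=
  xget (fun=> x0) [set x | is_trajectory a b policy x0 x].

Definition cost_from (R : realType) (a b : R) (policy : R -> R) (x0 : R) :
    \bar R :=
  (\int[@lebesgue_measure R]_(t in `[0%R, +oo[)
     ((trajectory a b policy x0 t) ^+ 2 +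
      (policy (trajectory a b policy x0 t)) ^+ 2)%:E)%E.

(* The first argument of [normal_prob] is the mean, the second one the standard
   deviation. *)
Definition cost (R : realType) (a b : R) (policy : R -> R) : \bar R :=
  if `[< {ae @normal_prob R 0 1, forall x0, defines_trajectory a b policy x0} >]
  then (\int[@normal_prob R 0 1]_x0 cost_from a b policy x0)%E
  else +oo%E.

Definition linear_policy (R : realType) (k : R) : R -> R := fun x => k * x.

Definition optimal_cost (R : realType) (a b : R) : \bar R :=
  ereal_inf [set cost a b (linear_policy k) | k in [set: R]].

Definition task_set (R : realType) (theta : R) : set R := `[theta^-1, 1].

Definition suboptimal_nbhd (R : realType) (a : R) (B : set R) (alpha : R)
    (policy : R -> R) : set R :=
  [set b | B b /\ (cost a b policy / optimal_cost a b <= alpha%:E)%E].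

Definition suboptimal_cover (R : realType) (a : R) (B : set R) (alpha : R)
    (C : set (R -> R)) : Prop :=
  \bigcup_(policy in C) suboptimal_nbhd a B alpha policy = B.

(* The infimum of the empty set is +oo, and a nonempty set of naturals attains
   its infimum. *)
Definition covering_number (R : realType) (a : R) (B : set R) (alpha : R) :
    \bar R :=
  ereal_inf [set (n%:R)%:E | n in [set n : nat |
    exists C : set (R -> R), (C #= `I_n)%card /\ suboptimal_cover a B alpha C]].

(* Main.v *)
Require Import Defs.
From mathcomp Require Import all_boot all_order all_algebra.
From mathcomp Require Import all_classical all_reals all_analysis.
From mathcomp Require Import measurable_realfun.
From mathcomp Require Import ring lra.

(** The number of policies needed grows like [ln theta] because one policy, however
nonlinear, can be nearly optimal only on tasks of comparable size: if it is
[alpha]-suboptimal for both [b1] and [b2], then [b2 <= K * b1] with [K]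
depending on [alpha] alone ([suboptimal_tasks_comparable]). The tasks
[r ^- i] with [r > K] and [i <= n] then need pairwise distinct policies, and they all
lie in [[1 / theta, 1]] once [r ^+ n <= theta].

The comparison rests on a tension between two tasks. Suppose that the
policy steers a state from above 2 to below 1 for the task [b1]. Going down past a level
[y] requires [y + b1 * policy y <= 0], so the control has size at least
[y / b1] at almost every level [y] of []1, 2[] ([drift_nonpos_ae]). For the
task [b2] the trajectory has to cross the same levels. With [u] the control, its speed
of descent is at most [- b2 * u], and [1 <= - b1 * u], so
that the running cost [u ^+ 2] is at least the speed of descent divided by
[b1 * b2]. Crossing [[1, 2]] therefore costs at least [1 / (b1 * b2)]
([cost_from_lower_bound]). On the other hand the linear gain [- 2 / b2] turns the
closed loop into [x' = - x], so the optimal cost is at most of order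
[1 / b2 ^+ 2] ([optimal_cost_le]). A policy within a factor [alpha] of it
satisfies [1 / (b1 * b2) <= const * alpha / b2 ^+ 2].

The policy is an arbitrary function and a trajectory is only absolutely continuous, so
crossing a level has to be understood almost everywhere. Both uses of it
come from one inequality ([first_passage_density]): if [tau y] is the
first time at which a path [x' = g] reaches the level [y], then the levels first
reached during a set [S] of times have measure at most the integral over [S]
of the negative part of [g]. When [S] is an interval, this says that the levels
met lie no further apart than the total descent of the path; outer regularity
of the Lebesgue measure extends it to Borel sets. Taking for [S] the times at which
the path goes up shows that almost no level is first reached while going up;
taking for [S] the times at which the [b2]-path is at an admissible level bounds the
descent from below by the full length 1. Since the first passage time
is monotone in the level, it is measurable, which supplies all the measurability of
the policy that is needed. *)

Set Implicit Arguments.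
Unset Strict Implicit.
Unset Printing Implicit Defensive.

Import Order.TTheory GRing.Theory Num.Theory.
Import numFieldNormedType.Exports.
Local Open Scope classical_set_scope.
Local Open Scope ring_scope.

Local Notation mu := (@lebesgue_measure _).

(** * Monotonicity and domination of integrals *)

(** The integral of a nonnegative function is a supremum over the simple functions
below it, hence monotone without any measurability. This matters because the cost is
not known to depend measurably on the initial state. *)
Lemma ge0_le_integral_pointwise (d : measure_display) (T : measurableType d)
    (R : realType) (m : {measure set T -> \bar R}) (D1 D2 : set T)
    (f1 f2 : T -> \bar R) :
  D1 `<=` D2 -> (forall x, D1 x -> (0 <= f1 x)%E) ->
  (forall x, D1 x -> (f1 x <= f2 x)%E) -> (forall x, D2 x -> (0 <= f2 x)%E) ->
  (\int[m]_(x in D1) f1 x <= \int[m]_(x in D2) f2 x)%E.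
Proof.
move=> D12 f10 f12 f20; rewrite !ge0_integralE//.
apply: le_ereal_sup => _ [h hf1 <-] /=; exists h => // x.
apply: le_trans (hf1 x) _; rewrite !patchE; case: ifPn => [/set_mem D1x|_].
  by rewrite mem_set; [exact: f12|exact: D12].
by case: ifPn => [/set_mem/f20|].
Qed.

(** An inequality between a measure and a density passes from intervals to open sets,
which are disjoint unions of intervals, and from there to Borel sets by outer
regularity and absolute continuity of the integral. *)
Lemma preimage_le_density (R : realType) (D : set R) (tau h : R -> R) :
  measurable D -> measurable_fun setT tau -> (forall t, 0 <= h t) ->
  mu.-integrable setT (EFin \o h) ->
  (forall J : set R, is_interval J ->
    (mu (D `&` tau @^-1` J) <= \int[mu]_(t in J) (h t)%:E)%E) ->
  forall S : set R, measurable S -> (mu S < +oo)%E ->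
    (mu (D `&` tau @^-1` S) <= \int[mu]_(t in S) (h t)%:E)%E.
Proof.
move=> mD mtau h0 hint DJ.
have mpre (S : set R) : measurable S -> measurable (D `&` tau @^-1` S).
  by move=> mS; apply: measurableI => //; rewrite -[_ @^-1` _]setTI; exact: mtau.
have mh := measurable_int _ hint.
have DU (U : set R) : open U ->
    (mu (D `&` tau @^-1` U) <= \int[mu]_(t in U) (h t)%:E)%E.
  move=> /OpenSetDisjointItvs.open_disjoint_itv[I [Iitv tI ->]].
  have mI k : measurable (I k) by apply: open_measurable; have [] := Iitv k.
  rewrite ge0_integral_bigcup//; last 2 first.
    exact: measurable_funTS.
    by move=> t _; rewrite lee_fin.
  rewrite preimage_bigcup setI_bigcupr measure_bigcup//; last 2 first.
    by move=> k _; exact: mpre.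
    apply/trivIsetP => i j _ _ ij; rewrite setIACA setIid -preimage_setI.
    by move/trivIsetP : tI => /(_ i j Logic.I Logic.I ij) ->; rewrite preimage_set0 setI0.
  rewrite (eq_eseriesl (Q := xpredT)); last by move=> k; rewrite in_setT.
  by apply: lee_nneseries => // k _; apply: DJ; have [] := Iitv k.
move=> S mS Sfin; apply/lee_addgt0Pr => e e0.
have [d [d0 hd]] := integral_normr_continuous hint e0.
have [U [oU SU Ud]] := lebesgue_regularity_outer mS Sfin d0.
have mU : measurable U by exact: open_measurable.
have mUS : measurable (U `\` S) by exact: measurableD.
rewrite (@le_trans _ _ (mu (D `&` tau @^-1` U)))//.
  rewrite le_measure ?inE//; [exact: mpre|exact: mpre|].
  by apply: setIS; exact: preimage_subset.
apply: le_trans (DU _ oU) _.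
rewrite -(setDUK SU) ge0_integral_setU//; last 3 first.
  exact: measurable_funTS.
  by move=> t _; rewrite lee_fin.
  by apply/disj_setPS => t [St [_ nSt]].
rewrite leeD2l//.
have := hd _ mUS Ud; rewrite /Rintegral -lte_fin fineK; last first.
  rewrite ge0_fin_numE; last by apply: integral_ge0 => t _; rewrite lee_fin.
  have /integrableP[_ /=] : mu.-integrable (U `\` S) (EFin \o h).
    exact: integrableS hint.
  by under eq_integral do rewrite ger0_norm//.
by move=> /ltW; under eq_integral do rewrite ger0_norm//.
Qed.

(** * First passage times *)

(** The infimum is a hitting time: above [y] continuity would delay it, and below [y]
the intermediate value theorem would give an earlier crossing. *)
Lemma first_passage_time (R : realType) (x : R -> R) (q y : R) :
  0 <= q -> {within `[0, q], continuous x} -> x q <= y -> y < x 0 ->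
  let tau := inf [set t | 0 <= t <= q /\ x t <= y] in
  0 <= tau <= q /\ x tau = y.
Proof.
move=> q0 cx xqy yx0; set E := [set t | _ /\ _] => tau.
have Eq : E q by rewrite /E /= lexx q0.
have lbE : lbound E 0 by move=> t [/andP[]].
have infE : has_inf E by split; [exists q | exists 0].
have tau0 : 0 <= tau by apply: lb_le_inf => //; exists q.
have tauq : tau <= q by apply: ge_inf => //; exists 0.
have tauE t : 0 <= t <= q -> x t <= y -> tau <= t.
  by move=> t0q xty; apply: ge_inf; [exists 0 | split].
split; first by rewrite tau0.
have tauI : `[0, q]%classic tau by rewrite /= in_itv /= tau0.
apply/eqP; rewrite eq_le; apply/andP; split.
  rewrite leNgt; apply/negP => yxtau.
  move/subspace_continuousP : cx => /(_ _ tauI) /cvgr_gt /(_ _ yxtau).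
  rewrite near_withinE => -[d /= d0 hd].
  have [e [e0q xey] etau] := inf_adherent d0 infE.
  (* some time before [tau + d] has value at most [y], yet [x > y] on that ball *)
  have etau_close : ball tau d e.
    by rewrite /ball /= distrC ger0_norm ?subr_ge0 ?tauE// ltrBlDl.
  have := hd e etau_close; rewrite /= in_itv /= e0q => /(_ isT).
  by rewrite ltNge xey.
rewrite leNgt; apply/negP => xtauy.
have [||c] := @IVT _ x 0 tau y tau0.
- apply: continuous_subspaceW cx; apply: subset_itvl.
  by rewrite bnd_simp.
- by rewrite ge_min le_max (ltW xtauy) (ltW yx0) orbT.
rewrite in_itv /= => /andP[c0 ctau] xc.
have /tauE : 0 <= c <= q by rewrite c0 (le_trans ctau).
rewrite xc lexx => /(_ isT) tauc.
have ctauE : c = tau by apply/eqP; rewrite eq_le ctau.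
by move: xtauy; rewrite -xc ctauE ltxx.
Qed.

Lemma measure_le_diameter (R : realType) (A : set R) (v : R) :
  measurable A -> 0 <= v ->
  (forall y1 y2, A y1 -> A y2 -> y1 < y2 -> y2 - y1 <= v) ->
  (mu A <= v%:E)%E.
Proof.
move=> mA v0 Av.
have [->|/set0P[a Aa]] := eqVneq A set0; first by rewrite measure0 lee_fin.
have Av' y1 y2 : A y1 -> A y2 -> y2 - v <= y1.
  move=> Ay1 Ay2; have [y21|y12] := leP y2 y1.
    by rewrite lerBlDr (le_trans y21)// lerDl.
  by rewrite lerBlDr -lerBlDl Av.
have lbA : has_lbound A by exists (a - v) => y Ay; exact: Av'.
have sub : A `<=` `[inf A, inf A + v].
  move=> y Ay; rewrite /= in_itv /= ge_inf//= -lerBlDr.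
  by apply: lb_le_inf; [exists a | move=> z Az; exact: Av'].
apply: (@le_trans _ _ (mu `[inf A, inf A + v])).
  by apply: le_measure; rewrite ?inE.
rewrite lebesgue_measure_itv /= lte_fin ltrDl; case: ifPn => _.
  by rewrite -EFinD addrAC subrr add0r.
by rewrite lee_fin.
Qed.

Lemma continuous_primitive (R : realType) (x g : R -> R) (q : R) :
  0 <= q -> mu.-integrable `[0, q] (EFin \o g) ->
  (forall t, 0 <= t <= q -> x t = x 0 + \int[mu]_(s in `[0, t]) g s) ->
  {within `[0, q], continuous x}.
Proof.
move=> q0 gint xg.
have xE : {in `[0, q]%classic, (fun t => x 0 + \int[mu]_(s in `[0, t]) g s) =1 x}.
  by move=> t /set_mem; rewrite /= in_itv /= => /xg ->.
apply: (subspace_eq_continuous xE) => t.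
apply: cvgD; first exact: cvg_cst.
exact: (parameterized_integral_continuous q0 gint).
Qed.

(** Two levels first reached during an interval [J] of times differ by minus the
integral of [g] between their passage times, thus by at most the integral over [J]
of the negative part of [g]. The set of such levels has a measure bounded by
its diameter, and [preimage_le_density] passes from intervals to Borel sets. *)
Lemma first_passage_density (R : realType) (x g : R -> R) (q : R) :
  0 <= q -> mu.-integrable `[0, q] (EFin \o g) ->
  (forall t, 0 <= t <= q -> x t = x 0 + \int[mu]_(s in `[0, t]) g s) ->
  exists tau : R -> R, [/\ measurable_fun setT tau,
    forall y, x q < y < x 0 -> 0 <= tau y <= q /\ x (tau y) = y &
    forall S : set R, measurable S -> S `<=` `[0, q] ->
      (mu (`]x q, x 0%R[ `&` tau @^-1` S) <=
       \int[mu]_(t in S) (Num.max (- g t) 0)%R%:E)%E].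
Proof.
move=> q0 gint xg.
have cx := continuous_primitive q0 gint xg.
(* capping the level from below by [x q] keeps the set of times nonempty, which
   makes [tau] monotone on the whole line *)
pose E y := [set t | 0 <= t <= q /\ x t <= Num.max y (x q)].
pose tau y := inf (E y).
have tauP y : x q < y < x 0 -> 0 <= tau y <= q /\ x (tau y) = y.
  move=> /andP[xqy yx0].
  have := first_passage_time q0 cx (ltW xqy) yx0.
  by rewrite /tau /E (max_idPl _)// ltW.
have tau_ni : nonincreasing_fun tau.
  move=> y1 y2 y12; apply: lb_le_inf.
    by exists q; split; rewrite ?lexx ?q0// le_max lexx orbT.
  move=> t [t0q xty]; apply: ge_inf; first by exists 0 => s [/andP[]].
  by split => //; apply: le_trans xty _; rewrite ge_max !le_max y12 lexx orbT.
have mtau : measurable_fun setT tau by exact: nonincreasing_measurable.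
exists tau; split=> // S mS Sq.
have mD : measurable `]x q, x 0[%classic by exact: measurable_itv.
have increment t1 t2 : 0 <= t1 -> t1 <= t2 -> t2 <= q ->
    x t2 - x t1 = \int[mu]_(t in `]t1, t2]) g t.
  move=> t10 t12 t2q.
  have t1q : t1 <= q := le_trans t12 t2q.
  have t20 : 0 <= t2 := le_trans t10 t12.
  rewrite (xg t2) ?t20// (xg t1) ?t10//.
  rewrite opprD addrACA subrr add0r Rintegral_itvB ?bnd_simp//.
  apply: integrableS gint => //; exact: subset_itvl.
pose h : R -> R := g^\- \_ `[0, q].
have h0 t : 0 <= h t by rewrite /h patchE; case: ifP.
have hint : mu.-integrable setT (EFin \o h).
  rewrite -restrict_EFin -integrable_mkcond//.
  exact: integrable_funrneg.
have -> : (\int[mu]_(t in S) (Num.max (- g t) 0)%R%:E = \int[mu]_(t in S) (h t)%:E)%E.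
  by apply: eq_integral => t /set_mem/Sq tq; rewrite /h patchE mem_set.
apply: preimage_le_density => //; last first.
  apply: (@le_lt_trans _ _ (mu `[0, q])); first by apply: le_measure; rewrite ?inE.
  by rewrite /= lebesgue_measure_itv /=; case: ifP => _; rewrite ?ltry// -EFinB ltry.
move=> J Jitv.
have mJ : measurable J by exact: is_interval_measurable.
have Jint : mu.-integrable J (EFin \o h) by exact: integrableS hint.
have Jfin : (\int[mu]_(t in J) (h t)%:E)%E \is a fin_num by exact: integrable_fin_num.
rewrite -(fineK Jfin); apply: measure_le_diameter.
- by apply: measurableI => //; rewrite -[_ @^-1` _]setTI; exact: mtau.
- by apply: fine_ge0; apply: integral_ge0 => t _; rewrite lee_fin.
move=> y1 y2 [/= y1D Jy1] [/= y2D Jy2] y12.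
move: y1D y2D; rewrite !in_itv/= => /tauP[/andP[t10 t1q] x1] /tauP[/andP[t20 t2q] x2].
have t21 : tau y2 <= tau y1 by apply: tau_ni; exact: ltW.
rewrite -{1}x1 -{1}x2 -opprB increment//.
set I12 := `]tau y2, tau y1]%classic.
have mI12 : measurable I12 by exact: measurable_itv.
have I12q : I12 `<=` `[0, q].
  move=> t; rewrite /I12 /= !in_itv/= => /andP[/ltW at2 t1].
  by rewrite (le_trans t20 at2) (le_trans t1 t1q).
have I12J : I12 `<=` J.
  move=> t; rewrite /I12 /= in_itv/= => /andP[/ltW at2 t1].
  by apply: Jitv Jy2 Jy1 _ _; rewrite at2.
have intI f : mu.-integrable `[0, q] (EFin \o f) -> mu.-integrable I12 (EFin \o f).
  by move=> fint; exact: integrableS fint.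
have hintI : mu.-integrable I12 (EFin \o h) by exact: integrableS hint.
apply: (@le_trans _ _ (\int[mu]_(t in I12) h t)).
  rewrite -subr_ge0 opprK -RintegralD//; last exact: intI.
  apply: Rintegral_ge0 => t /I12q tq.
  by rewrite /h patchE mem_set// /funrneg -lerBlDr sub0r le_max lexx.
rewrite /Rintegral -lee_fin !fineK//; first last.
  exact: integrable_fin_num.
apply: ge0_subset_integral => //; first exact: measurable_int Jint.
by move=> t _; rewrite lee_fin.
Qed.

(** * Lower bound on the cost along a trajectory *)

Section lower_bound.
Variables (R : realType) (policy : R -> R).

Lemma trajectory_primitive (a b x0 : R) (x : R -> R) :
  is_trajectory a b policy x0 x ->
  x 0 = x0 /\ forall t, 0 <= t ->
    x t = x 0 + \int[mu]_(s in `[0, t]) (a * x s + b * policy (x s)).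
Proof.
move=> xtraj; have x0E : x 0 = x0.
  by have [_ ->] := xtraj 0 (lexx 0); rewrite set_itv1 Rintegral_set1 addr0.
by split=> // t t0; rewrite x0E; have [] := xtraj t t0.
Qed.

(** A path that stays above a positive level has infinite cost. *)
Lemma trajectory_reaches (x : R -> R) (level : R) : 0 < level ->
  (\int[mu]_(t in `[0%R, +oo[) (x t ^+ 2 + policy (x t) ^+ 2)%:E < +oo)%E ->
  exists2 q, 0 <= q & x q <= level.
Proof.
move=> level0; apply: contraPP => noq; apply/negP; rewrite -leNgt.
have xlevel t : 0 <= t -> level < x t.
  by move=> t0; rewrite ltNge; apply/negP => xt; apply: noq; exists t.
apply: (@le_trans _ _ (\int[mu]_(t in `[0%R, +oo[) (level ^+ 2)%:E)%E).
  rewrite integral_cst//= lebesgue_measure_itv /= ltry.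
  by rewrite gt0_muley// lte_fin exprn_gt0.
apply: ge0_le_integral_pointwise => // [t _|t|t _].
- by rewrite lee_fin sqr_ge0.
- rewrite /= in_itv/= andbT => /xlevel xt; rewrite lee_fin.
  by rewrite ler_wpDr ?sqr_ge0// lerXn2r ?nnegrE ?(ltW level0)// ltW// (lt_trans level0).
- by rewrite lee_fin addr_ge0 ?sqr_ge0.
Qed.

(** The exceptional levels are those first reached at a time when the drift is
positive; the negative part of the drift vanishes at those times, so
[first_passage_density] makes these levels negligible. *)
Lemma drift_nonpos_ae (a b x0 : R) (x : R -> R) (q lo hi : R) :
  is_trajectory a b policy x0 x -> 0 <= q -> x q <= lo -> hi <= x0 ->
  exists N : set R, [/\ measurable N, mu N = 0%E &
    forall y, lo < y < hi -> ~ N y -> a * y + b * policy y <= 0].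
Proof.
move=> xtraj q0 xqlo hix0.
have [x0E xg] := trajectory_primitive xtraj; have [gint _] := xtraj q q0.
set g := fun t => a * x t + b * policy (x t) in xg gint.
have xgq t : 0 <= t <= q -> x t = x 0 + \int[mu]_(s in `[0, t]) g s.
  by move=> /andP[/xg].
have [tau [mtau tauP tau_le]] := first_passage_density q0 gint xgq.
pose S := `[0, q]%classic `&` g @^-1` `]0, +oo[.
have mS : measurable S.
  have /measurable_EFinP mg := measurable_int _ gint.
  by apply: mg => //; exact: measurable_itv.
exists (`]x q, x 0[%classic `&` tau @^-1` S); split.
- apply: measurableI => //; rewrite -[_ @^-1` _]setTI; exact: mtau.
- apply/eqP; rewrite eq_le measure_ge0 andbT.
  apply: le_trans (tau_le S mS _) _; first by move=> t [].
  rewrite integral0_eq// => t [_ /=]; rewrite in_itv/= andbT => gt0.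
  by rewrite (max_idPr _)// oppr_le0 ltW.
move=> y /andP[loy yhi] nNy.
have ypass : x q < y < x 0.
  by rewrite (le_lt_trans xqlo loy) x0E (lt_le_trans yhi hix0).
have [tauq xtau] := tauP y ypass.
rewrite -xtau -[leLHS]/(g (tau y)) leNgt; apply/negP => gpos; apply: nNy.
by split; rewrite /= ?in_itv//=; split; rewrite /= in_itv/= ?andbT.
Qed.

(** Stabilising the task [b1] forces [1 <= - b1 * u] at almost every level of
[]1, 2[], and then the descent rate [- z - b2 * u] of the task [b2] is at most
[b1 * b2 * u ^+ 2]. The levels of []1, 2[] have to be crossed, so the descent rate
integrates to at least 1. *)
Lemma cost_from_lower_bound (b1 b2 x1 x2 : R) : 0 < b1 -> 0 < b2 -> 2 < x1 -> 2 < x2 ->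
  defines_trajectory 1 b1 policy x1 -> defines_trajectory 1 b2 policy x2 ->
  (cost_from 1 b1 policy x1 < +oo)%E ->
  ((b1 * b2)^-1%:E <= cost_from 1 b2 policy x2)%E.
Proof.
have xgetT b x0 : defines_trajectory 1 b policy x0 ->
    is_trajectory 1 b policy x0 (trajectory 1 b policy x0).
  by move=> [x xtraj _]; apply: (xgetPex (fun=> x0)); exists x.
move=> b10 b20 x12 x22 /xgetT; set x := trajectory _ _ _ _ => xtraj /xgetT.
rewrite /cost_from -/x; set z := trajectory _ _ _ _ => ztraj.
move=> /(trajectory_reaches ltr01)[q q0 xq1].
have [N [mN N0 driftN]] := drift_nonpos_ae xtraj q0 xq1 (ltW x12).
have [|] := ltP (\int[mu]_(t in `[0%R, +oo[)
  (z t ^+ 2 + policy (z t) ^+ 2)%:E)%E +oo%E; last by apply: le_trans; rewrite leey.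
move=> /(trajectory_reaches ltr01)[p p0 zp1].
have [z0E zg] := trajectory_primitive ztraj; have [gint _] := ztraj p p0.
set g := fun t => 1 * z t + b2 * policy (z t) in zg gint.
have zgp t : 0 <= t <= p -> z t = z 0 + \int[mu]_(s in `[0, t]) g s.
  by move=> /andP[/zg].
have [tau [mtau tauP tau_le]] := first_passage_density p0 gint zgp.
pose good := `]1, 2[%classic `\` N.
have mgood : measurable good by exact: measurableD.
pose S := `[0, p]%classic `&` z @^-1` good.
have Sp : S `<=` `[0, p] by move=> t [].
have mS : measurable S.
  have : measurable_fun `[0, p] z.
    apply: subspace_continuous_measurable_fun => //.
    exact: continuous_primitive zgp.
  by apply.
have mu12 : mu `]1%R, 2%R[%classic = 1%E :> \bar R.
  by rewrite lebesgue_measure_itv /= lte_fin ltr1n -EFinB; congr (_%:E); lra.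
have good1 : mu good = 1%E.
  have -> : mu good = (mu `]1%R, 2%R[%classic - mu (`]1%R, 2%R[ `&` N))%E.
    by apply: measureD => //; apply: le_lt_trans (ltry 1); rewrite -mu12.
  rewrite mu12 (_ : mu (_ `&` N) = 0%E) ?sube0//.
  by apply: (subset_measure0 _ _ _ N0) => //; exact: measurableI.
have dwell : (1 <= \int[mu]_(t in S) (Num.max (- g t) 0)%R%:E)%E.
  rewrite -good1; apply: le_trans _ (tau_le S mS Sp).
  apply: le_measure; rewrite ?inE//.
    by apply: measurableI => //; rewrite -[_ @^-1` _]setTI; exact: mtau.
  move=> y goody; have [+ _] := goody; rewrite /= in_itv/= => /andP[y1 y2].
  have yD : z p < y < z 0 by rewrite (le_lt_trans zp1 y1) z0E (lt_trans y2 x22).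
  have [tauq ztau] := tauP y yD.
  by split; [rewrite /= in_itv|split; rewrite /= ?in_itv//= ztau].
have b120 : 0 < b1 * b2 by rewrite mulr_gt0.
rewrite -[leLHS]mule1.
apply: (le_trans (lee_wpmul2l _ dwell)); first by rewrite lee_fin invr_ge0 ltW.
have gS : mu.-integrable S (EFin \o g) by exact: integrableS gint.
rewrite -ge0_integralZl//; last 3 first.
- apply/measurable_EFinP; apply: measurable_maxr => //.
  apply: measurable_funN; apply/measurable_EFinP.
  exact: measurable_int gS.
- by move=> t _; rewrite lee_fin le_max lexx orbT.
- by rewrite lee_fin invr_ge0 ltW.
apply: ge0_le_integral_pointwise.
- by move=> t /Sp; rewrite /= !in_itv/= andbT => /andP[].
- by move=> t _; rewrite -EFinM lee_fin mulr_ge0 ?invr_ge0 ?(ltW b120)// le_max lexx orbT.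
- move=> t [_ [/= + nN]]; rewrite in_itv/= => /andP[z1 z2].
  have := driftN (z t); rewrite z1 z2 => /(_ isT nN).
  rewrite -EFinM lee_fin ler_pdivrMl// ge_max /g !mul1r => drift.
  set u := policy (z t) in drift *.
  have ub1 : 1 <= b1 * - u by lra.
  have u0 : 0 < - u by rewrite -(pmulr_rgt0 _ b10); lra.
  (* [cross] is [b1 * b2 * u ^+ 2 >= - b2 * u], the control being at least [1 / b1] *)
  have cross : 0 <= (b2 * - u) * (b1 * - u - 1).
    by rewrite mulr_ge0 ?subr_ge0// mulr_ge0// ltW.
  have zz : 0 <= b1 * b2 * z t ^+ 2 by rewrite mulr_ge0 ?sqr_ge0// ltW.
  have uu : 0 <= b1 * b2 * u ^+ 2 by rewrite mulr_ge0 ?sqr_ge0// ltW.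
  by apply/andP; split; rewrite mulrDr; nra.
- by move=> t _; rewrite lee_fin addr_ge0 ?sqr_ge0.
Qed.

End lower_bound.

(** * Gaussian initial states *)

Section gaussian.
Variable R : realType.
Local Notation gauss := (@normal_prob R 0 1).

Lemma normal_prob_itv_gt0 (a b : R) : a < b -> (0 < gauss `]a, b[%classic)%E.
Proof.
move=> ab; pose M := `|a| + `|b|; pose c : R := normal_pdf 0 1 M.
have c0 : 0 < c.
  by rewrite /c normal_pdfE ?oner_eq0// mulr_gt0 ?expR_gt0// normal_peak_gt0 ?oner_eq0.
apply: (@lt_le_trans _ _ (\int[mu]_(x in `]a, b[) c%:E)%E).
  rewrite integral_cst//= lebesgue_measure_itv /= lte_fin ab -EFinB -EFinM lte_fin.
  by rewrite mulr_gt0// subr_gt0.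
apply: ge0_le_integral_pointwise => // [x _|x|x _].
- by rewrite lee_fin ltW.
- rewrite /= in_itv/= => /andP[ax xb]; rewrite lee_fin /c !normal_pdfE ?oner_eq0//.
  rewrite ler_wpM2l ?normal_peak_ge0// ler_expR !mulNr lerN2 !subr0.
  rewrite ler_wpM2r ?invr_ge0 ?mulrn_wge0 ?sqr_ge0//.
  rewrite -[leLHS]real_normK ?num_real// lerXn2r ?nnegrE ?addr_ge0//.
  have := ler_norm (- a); rewrite normrN => la.
  have lb := ler_norm b; have a0 := normr_ge0 a; have b0 := normr_ge0 b.
  by rewrite /M ler_norml; apply/andP; split; lra.
- by rewrite lee_fin normal_pdf_ge0.
Qed.

(** The Radon-Nikodym derivative of the Gaussian measure agrees almost everywhere with
its density, because both have the same integrals over Borel sets. *)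
Lemma ge0_integral_normal_prob (f : R -> \bar R) :
  (forall x, (0 <= f x)%E) -> measurable_fun setT f ->
  (\int[gauss]_x f x = \int[mu]_x (f x * (normal_pdf 0 1 x)%:E))%E.
Proof.
move=> f0 mf; have dom := @normal_prob_dominates R 0 1.
rewrite -(Radon_Nikodym_SigmaFinite.change_of_variables dom)//.
have dint := Radon_Nikodym_SigmaFinite.f_integrable dom.
have mpdf : measurable_fun setT (EFin \o @normal_pdf R 0 1).
  by apply/measurable_EFinP; exact: measurable_normal_pdf.
apply: ge0_ae_eq_integral => //.
- by apply: emeasurable_funM => //; exact: measurable_int dint.
- exact: emeasurable_funM.
- by move=> x _; rewrite mule_ge0// Radon_Nikodym_SigmaFinite.f_ge0.
- by move=> x _; rewrite mule_ge0// lee_fin normal_pdf_ge0.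
apply: ae_eqe_mul2l; apply: integral_ae_eq => // E _ mE.
by rewrite -Radon_Nikodym_SigmaFinite.f_integral.
Qed.

(** The factor [x ^+ 2] is absorbed by a wider Gaussian: with [y = 3 / 8 * x ^+ 2] one
has [x ^+ 2 <= 8 / 3 * expR y], and [y] is the difference between the exponents of
the densities of standard deviation 2 and 1. *)
Lemma normal_second_moment_lty : (\int[gauss]_x (x ^+ 2)%:E < +oo)%E.
Proof.
pose K : R := 8 / 3 * normal_peak 1 / normal_peak 2.
have pk2 : 0 < @normal_peak R 2 by apply: normal_peak_gt0.
have K0 : 0 <= K by rewrite !mulr_ge0 ?invr_ge0 ?normal_peak_ge0.
rewrite ge0_integral_normal_prob; last 2 first.
- by move=> x; rewrite lee_fin sqr_ge0.
- by apply/measurable_EFinP; exact: measurable_funX.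
apply: (@le_lt_trans _ _ (\int[mu]_x (K%:E * (normal_pdf 0 2 x)%:E))%E); last first.
  rewrite ge0_integralZl//; first last.
  - by move=> x _; rewrite lee_fin normal_pdf_ge0.
  - by apply/measurable_EFinP; exact: measurable_normal_pdf.
  by rewrite integral_normal_pdf mule1 ltry.
apply: ge0_le_integral_pointwise => // [x _|x _|x _].
- by rewrite mule_ge0// lee_fin ?sqr_ge0 ?normal_pdf_ge0.
- rewrite -!EFinM lee_fin !normal_pdfE ?oner_eq0 ?pnatr_eq0//.
  rewrite /normal_fun !subr0 /K.
  pose y : R := 3 / 8 * x ^+ 2.
  have -> : expR (- x ^+ 2 / (2 ^+ 2 *+ 2)) = expR (- x ^+ 2 / (1 ^+ 2 *+ 2)) * expR y.
    by rewrite -expRD; congr expR; rewrite /y; field.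
  set e := expR (_ / _); set p1 := normal_peak 1; set p2 := normal_peak 2.
  have -> : 8 / 3 * p1 / p2 * (p2 * (e * expR y)) = (8 / 3 * expR y) * (p1 * e).
    by field; rewrite gt_eqF.
  rewrite ler_wpM2r ?mulr_ge0 ?expR_ge0 ?normal_peak_ge0//.
  have := expR_ge1Dx y; rewrite /y; lra.
- by rewrite mule_ge0// lee_fin normal_pdf_ge0.
Qed.

End gaussian.

Lemma ae_integral_ge (d : measure_display) (T : measurableType d)
    (R : realType) (m : {measure set T -> \bar R}) (A : set T)
    (good : T -> Prop) (f : T -> \bar R) (r : \bar R) :
  measurable A -> {ae m, forall x, good x} -> (0 <= r)%E ->
  (forall x, (0 <= f x)%E) -> (forall x, A x -> good x -> (r <= f x)%E) ->
  (r * m A <= \int[m]_x f x)%E.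
Proof.
move=> mA good_ae r0 f0 rf.
have [N [mN N0 badN]] : exists N, [/\ measurable N, m N = 0%E &
    ~` [set x | good x] `<=` N] by exact: good_ae.
have mAN : measurable (A `\` N) by exact: measurableD.
have <- : m (A `\` N) = m A.
  rewrite -(measureU0 mAN mN N0) -(measureU0 mA mN N0); congr (m _).
  apply/seteqP; split => x; first by move=> [[Ax _]|Nx]; [left|right].
  by have [Nx|nNx] := pselect (N x); [right|move=> [Ax|//]; left].
rewrite -integral_cst//; apply: ge0_le_integral_pointwise => // x [Ax nNx].
by apply: rf => //; apply: contrapT => /badN.
Qed.

Lemma cost_from_ge0 (R : realType) (a b : R) (policy : R -> R) (x0 : R) :
  (0 <= cost_from a b policy x0)%E.
Proof.
by apply: integral_ge0 => t _; rewrite lee_fin addr_ge0 ?sqr_ge0.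
Qed.

Lemma cost_ge0 (R : realType) (a b : R) (policy : R -> R) :
  (0 <= cost a b policy)%E.
Proof.
rewrite /cost; case: ifP => _ //.
by apply: integral_ge0 => x0 _; exact: cost_from_ge0.
Qed.

(** Initial states in []2, 3[] carry a positive Gaussian mass. A finite cost for [b1]
yields one of them with a finite cost, and that single state determines the
policy well enough for [cost_from_lower_bound] to apply to all of them. *)
Lemma cost_lower_bound (R : realType) (policy : R -> R) (b1 b2 : R) : 0 < b1 -> 0 < b2 ->
  (cost 1 b1 policy < +oo)%E ->
  ((b1 * b2)^-1%:E * @normal_prob R 0 1 `]2%R, 3%R[ <= cost 1 b2 policy)%E.
Proof.
move=> b10 b20; rewrite /cost.
case: asboolP => // good1 J1; case: asboolP => [good2|_]; last by rewrite leey.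
have A0 : (0 < @normal_prob R 0 1 `]2%R, 3%R[)%E.
  by apply: normal_prob_itv_gt0; rewrite ltr_nat.
have [x1 [x12 gx1 cx1]] : exists x1, [/\ 2 < x1,
    defines_trajectory 1 b1 policy x1 & (cost_from 1 b1 policy x1 < +oo)%E].
  apply: contrapT => nox1; move: J1; apply/negP; rewrite -leNgt.
  rewrite -[leLHS](gt0_mulye A0); apply: (ae_integral_ge _ good1) => //.
    by move=> x; exact: cost_from_ge0.
  move=> x; rewrite /= in_itv/= => /andP[x2 _] gx.
  by rewrite leNgt; apply/negP => cx; apply: nox1; exists x.
apply: (ae_integral_ge _ good2) => //.
- by rewrite lee_fin invr_ge0 mulr_ge0// ltW.
- by move=> x; exact: cost_from_ge0.
move=> x; rewrite /= in_itv/= => /andP[x2 _] gx.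
exact: cost_from_lower_bound gx1 gx cx1.
Qed.

(** * Upper bound on the optimal cost *)

Section linear_feedback.
Variable R : realType.

Let decay (x0 t : R) : R := x0 * expR (- t).

Let is_derive_decay (x0 t : R) : is_derive t 1 (decay x0) (- decay x0 t).
Proof.
rewrite /decay; apply: is_derive_eq.
by rewrite /GRing.scale /= mulrN1 mulrN.
Qed.

Let continuous_decay (x0 : R) : continuous (decay x0).
Proof.
move=> t; apply/differentiable_continuous/derivable1_diffP.
by have [] := is_derive_decay x0 t.
Qed.

Let feedback (b : R) (x : R -> R) (t : R) : b != 0 ->
  1 * x t + b * linear_policy (- 2 / b) (x t) = - x t.
Proof. by move=> b0; rewrite /linear_policy; field. Qed.

Lemma decay_trajectory (b x0 : R) : b != 0 ->
  is_trajectory 1 b (linear_policy (- 2 / b)) x0 (decay x0).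
Proof.
move=> b0 T T0.
rewrite (_ : (fun t => _) = (fun t => (- decay x0 t)%:E)); last first.
  by apply/funext => t; rewrite feedback.
have cND : continuous (fun t => - decay x0 t).
  by move=> t; apply: cvgN; exact: continuous_decay.
split.
  apply: continuous_compact_integrable; first exact: segment_compact.
  exact: continuous_subspaceT.
under eq_Rintegral do rewrite feedback//.
have [->|Tn0] := eqVneq T 0.
  by rewrite set_itv1 Rintegral_set1 addr0 /decay oppr0 expR0 mulr1.
have Tpos : 0 < T by rewrite lt_neqAle eq_sym Tn0.
rewrite /Rintegral (continuous_FTC2 (F := decay x0) Tpos)/=.
- by rewrite /decay oppr0 expR0; ring.
- exact: continuous_subspaceT.
- split; last 2 first.
    by apply: cvg_at_right_filter; exact: continuous_decay.
    by apply: cvg_at_left_filter; exact: continuous_decay.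
  by move=> t _; have [] := is_derive_decay x0 t.
- by move=> t _; rewrite derive1E; have [_] := is_derive_decay x0 t.
Qed.

(** The integral equation makes [y] continuous, hence differentiable on [t > 0] with
[y' = - y], so [expR t * y t] is constant. *)
Lemma decay_trajectory_unique (b x0 : R) (y : R -> R) : b != 0 ->
  is_trajectory 1 b (linear_policy (- 2 / b)) x0 y ->
  forall t, 0 <= t -> y t = decay x0 t.
Proof.
move=> b0 ytraj.
have [y0 _] := trajectory_primitive ytraj.
pose F t := \int[mu]_(s in `[0, t]) (- y s).
have yP t : 0 <= t ->
    mu.-integrable `[0, t] (EFin \o (fun s => - y s)) /\ y t = x0 + F t.
  move=> /ytraj[yint ->]; split.
    by apply: eq_integrable yint => // s _; rewrite /= feedback.
  by congr (_ + _); apply: eq_Rintegral => s _; rewrite feedback.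
move=> T T0; have T1 : 0 < T + 1 by rewrite ltr_pwDr.
have [yint _] := yP _ (ltW T1).
have cy : {within `[0, T + 1], continuous y}.
  apply: continuous_primitive yint _; first exact: ltW.
  by move=> t /andP[t0 _]; rewrite y0; have [] := yP t t0.
pose w := (expR : R -> R) * (cst x0 + F).
have dw t : t \in `]0, T[ -> is_derive t 1 w ((fun=> 0) t).
  rewrite in_itv/= => /andP[t0 tT].
  have tT1 : t < T + 1 by rewrite (lt_trans tT)// ltrDl.
  have cyt : {for t, continuous (fun s => - y s)}.
    apply: cvgN; apply: (within_continuous_continuous T1 cy).
    by rewrite in_itv/= t0.
  have [dF F'] := continuous_FTC1_closed tT1 yint t0 cyt.
  have isdF : is_derive t 1 F (- y t) by apply: DeriveDef; rewrite -?derive1E.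
  apply: is_derive_eq.
  rewrite /GRing.scale /= add0r; have [_ ->] := yP t (ltW t0).
  rewrite -[(cst x0 + F) t]/(x0 + F t); ring.
have cw : {within `[0, T], continuous w}.
  move=> t; apply: cvgM.
    by apply: continuous_subspaceT => s; exact: continuous_expR.
  apply: cvgD; first exact: cvg_cst.
  have [yintT _] := yP T T0.
  exact: (parameterized_integral_continuous T0 yintT).
have [c _] := MVT_segment T0 dw cw.
have wE t : 0 <= t -> w t = expR t * y t.
  by move=> /yP[_ ->].
rewrite mul0r !wE// y0 expR0 mul1r => /eqP; rewrite subr_eq0 => /eqP <-.
by rewrite /decay mulrC mulrA -expRD addNr expR0 mul1r.
Qed.

(** The running cost is proportional to [expR (- 2 * t)], that is, to the exponential
density of rate 2. *)
Lemma cost_from_decay (b x0 : R) : b != 0 ->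
  cost_from 1 b (linear_policy (- 2 / b)) x0 =
  (((1 + (- 2 / b) ^+ 2) / 2)%:E * (x0 ^+ 2)%:E)%E.
Proof.
move=> b0; set k := - 2 / b; rewrite /cost_from.
have xtraj : is_trajectory 1 b (linear_policy k) x0
    (trajectory 1 b (linear_policy k) x0).
  apply: (xgetPex (fun=> x0)); exists (decay x0); exact: decay_trajectory.
have xE := decay_trajectory_unique b0 xtraj.
pose C : R := (1 + k ^+ 2) / 2 * x0 ^+ 2.
transitivity (\int[mu]_(t in `[0%R, +oo[) (C%:E * (exponential_pdf 2 t)%:E))%E.
  apply: eq_integral => t; rewrite inE /= in_itv/= andbT => t0.
  rewrite xE// -EFinM exponential_pdfE// /decay /linear_policy /C; congr (_%:E).
  have -> : expR (- 2 * t) = expR (- t) ^+ 2.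
    by rewrite expr2 -expRD; congr expR; ring.
  by field.
have pdf0 t : (0 <= (exponential_pdf 2 t : R)%:E)%E.
  by rewrite lee_fin exponential_pdf_ge0.
rewrite ge0_integralZl//; last 2 first.
- by apply: measurable_funTS; apply/measurable_EFinP; exact: measurable_exponential_pdf.
- by rewrite lee_fin mulr_ge0 ?sqr_ge0// divr_ge0// addr_ge0 ?sqr_ge0.
suff -> : (\int[mu]_(t in `[0%R, +oo[) (exponential_pdf 2 t : R)%:E = 1)%E.
  by rewrite mule1 -EFinM.
rewrite -[RHS](@integral_exponential_pdf R 2)// integral_mkcond.
apply: eq_integral => t _; rewrite patchE; case: ifPn => // /negP.
rewrite inE /= in_itv/= andbT => /negP; rewrite -ltNge => t0.
by rewrite lt0_exponential_pdf.
Qed.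

(** The gain [- 2 / b] turns the closed loop into [x' = - x] for every task, so the only
dependence of the cost on [b] comes from the factor [1 + 4 / b ^+ 2]. *)
Lemma optimal_cost_le : exists2 C : R, 0 <= C &
  forall b, 0 < b <= 1 -> (optimal_cost 1 b <= (C / b ^+ 2)%:E)%E.
Proof.
pose m2 := (\int[@normal_prob R 0 1]_x (x ^+ 2)%:E)%E.
have m20 : (0 <= m2)%E by apply: integral_ge0 => x _; rewrite lee_fin sqr_ge0.
have m2fin : m2 \is a fin_num by rewrite ge0_fin_numE//; exact: normal_second_moment_lty.
exists (5 / 2 * fine m2); first by rewrite mulr_ge0// fine_ge0.
move=> b /andP[b0 b1]; have bn0 : b != 0 by rewrite gt_eqF.
apply: ereal_inf_le; exists (cost 1 b (linear_policy (- 2 / b))).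
  by exists (- 2 / b).
have good : {ae @normal_prob R 0 1, forall x0,
    defines_trajectory 1 b (linear_policy (- 2 / b)) x0}.
  apply: aeW => x0; exists (decay x0); first exact: decay_trajectory.
  by move=> y ytraj t t0; exact: decay_trajectory_unique ytraj _ _.
rewrite /cost; case: asboolP => // _.
under eq_integral do rewrite cost_from_decay//.
rewrite ge0_integralZl//; last 3 first.
- by apply/measurable_EFinP; exact: measurable_funX.
- by move=> x _; rewrite lee_fin sqr_ge0.
- by rewrite lee_fin divr_ge0// addr_ge0 ?sqr_ge0.
rewrite -/m2 -(fineK m2fin) -EFinM lee_fin [leRHS]mulrAC ler_wpM2r ?fine_ge0//.
rewrite -subr_ge0.
have -> : 5 / 2 / b ^+ 2 - (1 + (- 2 / b) ^+ 2) / 2 = (1 - b ^+ 2) / (2 * b ^+ 2).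
  by field.
have b21 : b ^+ 2 <= 1 by rewrite expr_le1// ltW.
by rewrite divr_ge0 ?subr_ge0// mulr_ge0 ?sqr_ge0.
Qed.

End linear_feedback.

(** * Covering by suboptimal neighborhoods *)

Section covering.
Variable R : realType.

Lemma cost_le_of_ratio (policy : R -> R) (alpha b M : R) : 0 < b ->
  (optimal_cost 1 b <= M%:E)%E ->
  (cost 1 b policy / optimal_cost 1 b <= alpha%:E)%E ->
  exists2 J : R, cost 1 b policy = J%:E & J <= alpha * M.
Proof.
move=> b0; have J0 := cost_ge0 1 b policy.
have : (0 <= optimal_cost 1 b)%E.
  by apply: le_ereal_inf_tmp => _ [k _ <-]; exact: cost_ge0.
case: (optimal_cost 1 b) => [r| |]//; rewrite !lee_fin => r0 rM.
have [rz|rn0] := eqVneq r 0.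
  (* the inverse of 0 is infinite, so a zero optimum makes the ratio infinite: by
     [cost_lower_bound] with both tasks equal to [b], no cost is zero *)
  rewrite rz inver eqxx => ratio; exfalso; move: ratio; apply/negP.
  rewrite -ltNge gt0_muley ?ltry//.
  have [Jfin|] := ltP (cost 1 b policy) +oo%E; last exact: lt_le_trans.
  apply: lt_le_trans (cost_lower_bound b0 b0 Jfin); rewrite mule_gt0//.
    by rewrite lte_fin invr_gt0 mulr_gt0.
  by apply: normal_prob_itv_gt0; rewrite ltr_nat.
have rpos : 0 < r by rewrite lt_neqAle eq_sym rn0.
rewrite inver (negbTE rn0).
move: J0; case: (cost 1 b policy) => [J| |]//; rewrite ?lee_fin => J0; last first.
  by rewrite gt0_mulye ?lte_fin ?invr_gt0.
rewrite ler_pdivrMr// => Jr; exists J => //.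
have alpha0 : 0 <= alpha by rewrite -(pmulr_lge0 _ rpos) (le_trans J0).
by rewrite (le_trans Jr)// ler_wpM2l.
Qed.

(** Compare the lower bound [p / (b1 * b2)] of [cost_lower_bound], where [p] is the
mass of []2, 3[], with the upper bound [alpha * C / b2 ^+ 2]. *)
Lemma suboptimal_tasks_comparable (alpha : R) : 0 <= alpha ->
  exists K : R, forall (policy : R -> R) (b1 b2 : R),
    0 < b1 <= 1 -> 0 < b2 <= 1 ->
    (cost 1 b1 policy / optimal_cost 1 b1 <= alpha%:E)%E ->
    (cost 1 b2 policy / optimal_cost 1 b2 <= alpha%:E)%E ->
    b2 <= K * b1.
Proof.
move=> alpha0; have [C C0 optC] := optimal_cost_le R.
pose p := @normal_prob R 0 1 `]2%R, 3%R[.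
have pfin : p \is a fin_num by exact: fin_num_measure.
have p0 : 0 < fine p.
  rewrite -lte_fin fineK//.
  by apply: normal_prob_itv_gt0; rewrite ltr_nat.
exists (alpha * C / fine p) => policy b1 b2 b1I b2I.
move: (b1I) (b2I) => /andP[b10 _] /andP[b20 _].
move=> /(cost_le_of_ratio b10 (optC _ b1I))[J1 J1E _].
move=> /(cost_le_of_ratio b20 (optC _ b2I))[J2 J2E J2le].
have := @cost_lower_bound R policy b1 b2 b10 b20.
rewrite J1E J2E ltry -/p -(fineK pfin) -EFinM lee_fin => /(_ isT) J2ge.
have := le_trans J2ge J2le.
rewrite mulrC ler_pdivrMr ?mulr_gt0// => pC.
rewrite mulrAC ler_pdivlMr//.
have cancel_b2 : alpha * (C / b2 ^+ 2) * (b1 * b2) = alpha * C * b1 / b2.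
  by field; rewrite gt_eqF.
by move: pC; rewrite cancel_b2 ler_pdivlMr// mulrC.
Qed.

End covering.

Theorem theorem9 (R : realType) (alpha : R) (halpha : 3 / 2 <= alpha) :
  exists c : R, 0 < c /\
    \forall theta \near +oo,
      ((c * ln theta)%:E <= covering_number 1 (task_set theta) alpha)%E.
Proof.
have alpha0 : 0 <= alpha by apply: le_trans halpha; rewrite divr_ge0.
have [K comparable] := suboptimal_tasks_comparable alpha0.
pose r : R := Num.max K 1 + 1.
have Kr : K < r by rewrite ltr_pwDr// le_max lexx.
have r1 : 1 < r by rewrite ltr_pwDr// le_max lexx orbT.
have r0 : 0 < r by exact: lt_trans r1.
exists (ln r)^-1; split; first by rewrite invr_gt0 ln_gt0.
near=> theta.
have theta0 : 0 < theta by near: theta; exact: nbhs_pinfty_gt.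
apply: le_ereal_inf_tmp => _ [n [C [cardC coverC]] <-]; rewrite lee_fin.
rewrite ler_pdivrMl ?ln_gt0// mulrC.
suff theta_lt : theta < r ^+ n.
  by rewrite mulr_natl -lnXn// ler_ln ?posrE ?exprn_gt0// ltW.
rewrite ltNge; apply/negP => rn_theta.
pose b i : R := r ^- i.
have bI i : 0 < b i <= 1.
  by rewrite /b invr_gt0 exprn_gt0//= invf_le1 ?exprn_gt0// exprn_ege1 ?ltW.
have choose_policy i : exists policy, (i <= n)%N -> C policy /\
    (cost 1 (b i) policy / optimal_cost 1 (b i) <= alpha%:E)%E.
  have [ni|ni] := leqP i n; last by exists id.
  have : task_set theta (b i).
    rewrite /task_set /= in_itv/=; have /andP[_ ->] := bI i.
    rewrite andbT /b lef_pV2 ?posrE ?exprn_gt0//.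
    by rewrite (le_trans _ rn_theta)// ler_weXn2l// ltW.
  by rewrite -{1}coverC => -[policy Cp [_ ratio]]; exists policy.
have [policy policyP] := choice choose_policy.
(* a policy shared by [b i] and [b j] with [i < j] would give [r ^+ (j - i) <= K] *)
have policy_inj : {in `I_n.+1 &, injective policy}.
  suff lt_neq i j : (i < j)%N -> (j <= n)%N -> policy i <> policy j.
    move=> i j; rewrite !inE /= !ltnS => ni nj pij.
    have [ij|ji|//] := ltngtP i j; first by case: (lt_neq _ _ ij nj).
    by case: (lt_neq _ _ ji ni).
  move=> ij nj pij; have [_ costj] := policyP j nj.
  have [_ costi] := policyP i (leq_trans (ltnW ij) nj).
  rewrite -pij in costj.
  have := comparable _ _ _ (bI j) (bI i) costj costi.
  rewrite /b -ler_pdivrMr ?invr_gt0 ?exprn_gt0// invrK mulrC -expfB//.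
  apply/negP; rewrite -ltNge (lt_le_trans Kr)//.
  rewrite -[leLHS]expr1 ler_weXn2l ?subn_gt0//; exact: ltW.
have : (`I_n.+1 #<= `I_n)%card.
  rewrite -(card_le_eqr cardC) -(card_le_eql (inj_card_eq policy_inj)).
  apply: subset_card_le => _ [i /= ni <-].
  by have [] := policyP i ni.
by rewrite card_le_II ltnn.
Unshelve. all: by end_near.
Qed.
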